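(* Let $n\ge 1$ and let $D(S_n)$ be the Drinfeld double of the group algebra $kS_n$ of the symmetric group $S_n$. Then every simple $D(S_n)$-module has Schur indicator equal to $1$.
   Context: $k$ is an algebraically closed field of characteristic not $2$ and not dividing $|S_n|$ (so that $D(S_n)$ and its dual are semisimple). For a finite group $G$, the Drinfeld double $D(G)$ is the Hopf algebra with basis $p_g\bowtie x$ ($g,x\in G$), product $(p_g\bowtie z)(p_h\bowtie y)=\delta_{g,zhz^{-1}}\,p_g\bowtie zy$, unit $\sum_g p_g\bowtie 1$, coproduct $\Delta(p_g\bowtie x)=\sum_{h\in G}(p_h\bowtie x)\otimes(p_{h^{-1}g}\bowtie x)$, counit $\varepsilon(p_g\bowtie x)=\delta_{g,1}$, antipode $S(p_g\bowtie x)=p_{x^{-1}g^{-1}x}\bowtie x^{-1}$. The Schur indicator of a simple $H$-module with character $\chi$ over a semisimple Hopf algebra $H$ is $\nu(\chi)=\chi(\sum\Lambda_1\Lambda_2)$, where $\Lambda$ is the integral of $H$ with $\varepsilon(\Lambda)=1$. *)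

(* Defs.v *)
From HB Require Import structures.
From mathcomp Require Import all_boot all_order all_algebra all_fingroup.
From mathcomp Require Import all_field.

Set Implicit Arguments.
Unset Strict Implicit.
Unset Printing Implicit Defensive.

Import GRing.Theory VectorInternalTheory passmx.
Local Open Scope ring_scope.

(* Tensor products of finite-dimensional vector spaces, as matrices of        *)
(* coordinates: the (i, j) entry of u \ot v is the product of the i-th        *)
(* coordinate of u and the j-th coordinate of v.                              *)
Section Tensor.
Variable k : fieldType.

Definition tensor (U V : vectType k) : vectType k := 'M[k]_(dim U, dim V).

Definition tens (U V : vectType k) (u : U) (v : V) : tensor U V :=
  (v2r u)^T *m v2r v.

(* The linear map on the tensor product induced by a bilinear map f; it is    *)
(* computed on the bases of U and V underlying v2r.                           *)
Definition tlift (U V W : vectType k) (f : U -> V -> W) (t : tensor U V) : W :=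
  \sum_i \sum_j (t : 'M_(_, _)) i j *:
    f (r2v (delta_mx 0 i)) (r2v (delta_mx 0 j)).

Lemma tlift_is_linear (U V W : vectType k) (f : U -> V -> W) :
  linear (@tlift U V W f).
Proof.
move=> c s t; rewrite /tlift scaler_sumr -big_split; apply: eq_bigr => i _ /=.
rewrite scaler_sumr -big_split; apply: eq_bigr => j _ /=.
by rewrite !mxE scalerDl scalerA.
Qed.
HB.instance Definition _ (U V W : vectType k) (f : U -> V -> W) :=
  GRing.isLinear.Build k (tensor U V) W _ (@tlift U V W f)
    (@tlift_is_linear U V W f).

Lemma tlift_linearl (T U V W : vectType k) (f : T -> U -> V -> W) t :
  (forall u v, linear (fun x : T => f x u v)) ->
  linear (fun x : T => tlift (f x) t).
Proof.
move=> fl c x y; rewrite /tlift scaler_sumr -big_split; apply: eq_bigr => i _.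
rewrite /= scaler_sumr -big_split; apply: eq_bigr => j _ /=.
by rewrite fl scalerDr !scalerA mulrC.
Qed.

Lemma tlift_linearP (U V W : vectType k) (f g : U -> V -> W) c t :
  tlift (fun u v => c *: f u v + g u v) t = c *: tlift f t + tlift g t.
Proof.
rewrite /tlift scaler_sumr -big_split; apply: eq_bigr => i _ /=.
rewrite scaler_sumr -big_split; apply: eq_bigr => j _ /=.
by rewrite scalerDr !scalerA mulrC.
Qed.

Lemma eq_tlift (U V W : vectType k) (f g : U -> V -> W) t :
  f =2 g -> tlift f t = tlift g t.
Proof.
by move=> fg; apply: eq_bigr => i _; apply: eq_bigr => j _; rewrite fg.
Qed.

Lemma tens_linearl (U V : vectType k) (v : V) : linear (fun u : U => tens u v).
Proof.
by move=> c u u'; rewrite /tens linearP /= linearP /= mulmxDl -scalemxAl.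
Qed.

Lemma tens_linearr (U V : vectType k) (u : U) : linear (fun v : V => tens u v).
Proof. by move=> c v v'; rewrite /tens linearP /= mulmxDr -scalemxAr. Qed.

Lemma tens_suml (U V : vectType k) (I : finType) (F : I -> U) (v : V) :
  tens (\sum_i F i) v = \sum_i tens (F i) v.
Proof.
by rewrite /tens linear_sum /= linear_sum /= mulmx_suml.
Qed.

Lemma tens_sumr (U V : vectType k) (I : finType) (u : U) (F : I -> V) :
  tens u (\sum_i F i) = \sum_i tens u (F i).
Proof. by rewrite /tens linear_sum mulmx_sumr. Qed.

Lemma tens0l (U V : vectType k) (v : V) : tens (0 : U) v = 0.
Proof. by rewrite /tens !linear0 mul0mx. Qed.

Lemma tensZr (U V : vectType k) (u : U) c (v : V) :
  tens u (c *: v) = c *: tens u v.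
Proof. by rewrite /tens linearZ /= -scalemxAr. Qed.

Lemma v2r_expand (U : vectType k) (u : U) :
  u = \sum_i v2r u 0 i *: r2v (delta_mx 0 i).
Proof.
apply: (can_inj v2rK); rewrite linear_sum [LHS]row_sum_delta.
by apply: eq_bigr => i _; rewrite linearZ /= r2vK.
Qed.

Lemma tlift_tens (U V W : vectType k) (f : U -> V -> W) (u : U) (v : V) :
  (forall v, linear (fun u : U => f u v)) ->
  (forall u, linear (fun v : V => f u v)) ->
  tlift f (tens u v) = f u v.
Proof.
move=> fl fr.
pose fL v0 : {linear U -> W} := HB.pack (f ^~ v0)
  (GRing.isLinear.Build k U W _ (f ^~ v0) (fl v0)).
pose fR u0 : {linear V -> W} := HB.pack (f u0)
  (GRing.isLinear.Build k V W _ (f u0) (fr u0)).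
rewrite [in RHS](v2r_expand u) -[RHS]/(fL v _) linear_sum.
apply: eq_bigr => i _; rewrite linearZ /= [in RHS](v2r_expand v).
rewrite -[f _ _]/(fR _ _) linear_sum scaler_sumr.
apply: eq_bigr => j _; rewrite linearZ /= scalerA; congr (_ *: _).
by rewrite !mxE big_ord1 !mxE.
Qed.

End Tensor.

HB.mixin Record Falgebra_isHopf (k : fieldType) H of Falgebra k H := {
  comul : {linear H -> tensor H H};
  counit : {linear H -> k^o};
  antipode : {linear H -> H};
  comulA : forall a : H,
    tlift (fun b c => tlift (fun d e => tens (tens b d) e) (comul c)) (comul a)
      = tlift (fun b c => tens (comul b) c) (comul a);
  counitl : forall a : H, tlift (fun b c => counit b *: c) (comul a) = a;
  counitr : forall a : H, tlift (fun b c => counit c *: b) (comul a) = a;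
  comul1 : comul 1 = tens (1 : H) (1 : H);
  comulM : forall a b : H,
    comul (a * b) = tlift (fun c d => tlift (fun e f => tens (c * e) (d * f))
                                            (comul b)) (comul a);
  counit1 : counit 1 = 1;
  counitM : forall a b : H, counit (a * b) = counit a * counit b;
  antipodel : forall a : H,
    tlift (fun b c => antipode b * c) (comul a) = (counit a : k)%:A;
  antipoder : forall a : H,
    tlift (fun b c => b * antipode c) (comul a) = (counit a : k)%:A
}.

#[short(type="hopfType")]
HB.structure Definition Hopf (k : fieldType) :=
  { H of Falgebra k H & Falgebra_isHopf k H }.

Section Modules.
Variable k : fieldType.

(* Finite-dimensional left modules; (f \o g)%VF maps v to f (g v). Simple     *)
(* modules over a finite-dimensional algebra are finite-dimensional.          *)
Record lmodule (A : falgType k) (V : vectType k) := LModule {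
  module_act :> {linear A -> 'End(V)};
  module_act1 : module_act 1 = \1%VF;
  module_actM : forall a b : A,
    module_act (a * b) = (module_act a \o module_act b)%VF
}.

Definition simple_module (A : falgType k) (V : vectType k)
    (M : lmodule A V) : Prop :=
  fullv != 0%VS :> {vspace V} /\
  forall U : {vspace V}, (forall a : A, (M a @: U <= U)%VS) ->
    U = 0%VS \/ U = fullv.

Definition lfun_trace (V : vectType k) (f : 'End(V)) : k :=
  \tr (mxof (vbasis fullv) (vbasis fullv) f).

Definition character (A : falgType k) (V : vectType k)
  (M : lmodule A V) (a : A) : k := lfun_trace (M a).

Definition integral (H : hopfType k) (L : H) : Prop :=
  forall a : H, a * L = (counit a : k) *: L /\ L * a = (counit a : k) *: L.

Definition normalized_integral (H : hopfType k) (L : H) : Prop :=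
  integral L /\ counit L = 1.

Lemma normalized_integral_uniq (H : hopfType k) (L L' : H) :
  normalized_integral L -> normalized_integral L' -> L = L'.
Proof.
move=> [iL eL] [iL' eL']; have [+ _] := iL L'; have [_ ->] := iL' L.
by rewrite eL eL' !scale1r.
Qed.

(* The integral L is meant to satisfy normalized_integral L, which determines *)
(* it.                                                                        *)
Definition schur_indicator (H : hopfType k) (L : H) (V : vectType k)
  (M : lmodule H V) : k := character M (tlift *%R (comul L)).

End Modules.

(* The element a has coefficient a (g, x) on p_g \bowtie x.                    *)
Definition drinfeld_double (k : fieldType) (gT : finGroupType) : Type :=
  {ffun gT * gT -> k^o}.

Section DrinfeldDouble.
Variables (k : fieldType) (gT : finGroupType).
Notation D := (drinfeld_double k gT).

HB.instance Definition _ := Vector.copy D {ffun gT * gT -> k^o}.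

Definition bowtie (g x : gT) : D := [ffun j => (j == (g, x))%:R].

(* The linear map with value F g x at bowtie g x.                             *)
Definition dlin (W : lmodType k) (F : gT -> gT -> W) (a : D) : W :=
  \sum_g \sum_x a (g, x) *: F g x.

Lemma dlin_is_linear (W : lmodType k) (F : gT -> gT -> W) : linear (@dlin W F).
Proof.
move=> c s t; rewrite /dlin scaler_sumr -big_split; apply: eq_bigr => i _ /=.
rewrite scaler_sumr -big_split; apply: eq_bigr => j _ /=.
by rewrite !ffunE scalerDl scalerA.
Qed.
HB.instance Definition _ (W : lmodType k) (F : gT -> gT -> W) :=
  GRing.isLinear.Build k D W _ (@dlin W F) (@dlin_is_linear W F).

Lemma dlin_bowtie (W : lmodType k) (F : gT -> gT -> W) g x :
  dlin F (bowtie g x) = F g x.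
Proof.
rewrite /dlin (bigD1 g) //= [X in _ + X]big1 => [|h /negPf hg].
  rewrite addr0 (bigD1 x) //= [X in _ + X]big1 => [|y /negPf yx].
    by rewrite ffunE eqxx scale1r addr0.
  by rewrite ffunE xpair_eqE yx andbF scale0r.
by rewrite big1 // => y _; rewrite ffunE xpair_eqE hg scale0r.
Qed.

Lemma dlin_id (a : D) : dlin bowtie a = a.
Proof.
apply/ffunP => -[g x]; rewrite /dlin sum_ffunE (bigD1 g) //=.
rewrite [X in _ + X]big1 => [|h /negPf hg].
  rewrite addr0 sum_ffunE (bigD1 x) //= [X in _ + X]big1 => [|y /negPf yx].
    by rewrite !ffunE eqxx addr0 [LHS]mulr1.
  by rewrite !ffunE xpair_eqE [x == y]eq_sym yx andbF [LHS]mulr0.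
rewrite sum_ffunE big1 // => y _.
by rewrite !ffunE xpair_eqE [g == h]eq_sym hg [LHS]mulr0.
Qed.

Lemma drinfeld_double_ext (W : lmodType k) (f f' : D -> W) :
  linear f -> linear f' ->
  (forall g x, f (bowtie g x) = f' (bowtie g x)) -> f =1 f'.
Proof.
move=> lf lf' eqf a.
pose F : {linear D -> W} := HB.pack f (GRing.isLinear.Build k D W _ f lf).
pose F' : {linear D -> W} := HB.pack f' (GRing.isLinear.Build k D W _ f' lf').
rewrite -(dlin_id a) -[LHS]/(F _) -[RHS]/(F' _) /dlin !linear_sum.
apply: eq_bigr => g _; rewrite !linear_sum; apply: eq_bigr => x _.
by rewrite !linearZ /= eqf.
Qed.

Definition dmul (a b : D) : D :=
  dlin (fun g z => dlin (fun h y =>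
    (g == (z * h * z^-1)%g)%:R *: bowtie g (z * y)%g) b) a.

Definition dunit : D := \sum_g bowtie g 1%g.

Lemma dmul_linearl b : linear (dmul^~ b).
Proof. by move=> c a a'; rewrite /dmul linearP. Qed.

Lemma dmul_linearr a : linear (dmul a).
Proof.
move=> c b b'; rewrite /dmul /dlin scaler_sumr -big_split.
apply: eq_bigr => g _ /=; rewrite scaler_sumr -big_split.
apply: eq_bigr => z _ /=.
rewrite -![\sum_g0 \sum_x _]/(dlin _ _) linearP /=.
by rewrite scalerDr !scalerA mulrC.
Qed.

Let dmulL b : {linear D -> D} := HB.pack (dmul^~ b)
  (GRing.isLinear.Build k D D _ (dmul^~ b) (dmul_linearl b)).
Let dmulR a : {linear D -> D} := HB.pack (dmul a)
  (GRing.isLinear.Build k D D _ (dmul a) (dmul_linearr a)).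

Lemma dmulDl : left_distributive dmul +%R.
Proof. by move=> a b c; apply: (linearD (dmulL c)). Qed.
Lemma dmulDr : right_distributive dmul +%R.
Proof. by move=> a b c; apply: (linearD (dmulR a)). Qed.
Lemma dmulZl (c : k) a b : dmul (c *: a) b = c *: dmul a b.
Proof. exact: (linearZ_LR (dmulL b)). Qed.
Lemma dmulZr (c : k) a b : dmul a (c *: b) = c *: dmul a b.
Proof. exact: (linearZ_LR (dmulR a)). Qed.
Lemma dmul_suml (I : finType) (F : I -> D) b :
  dmul (\sum_i F i) b = \sum_i dmul (F i) b.
Proof. exact: (linear_sum (dmulL b)). Qed.
Lemma dmul_sumr (I : finType) (F : I -> D) a :
  dmul a (\sum_i F i) = \sum_i dmul a (F i).
Proof. exact: (linear_sum (dmulR a)). Qed.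

Lemma dmul_bowtie g z h y : dmul (bowtie g z) (bowtie h y) =
  (g == (z * h * z^-1)%g)%:R *: bowtie g (z * y)%g.
Proof. by rewrite /dmul !dlin_bowtie. Qed.

Lemma dmulA : associative dmul.
Proof.
move=> a b c.
have l1 (x y : D) : linear (fun a : D => dmul a (dmul x y)).
  by move=> ? ? ?; rewrite dmulDl dmulZl.
have l2 (x y : D) : linear (fun a : D => dmul (dmul a x) y).
  by move=> ? ? ?; rewrite !(dmulDl, dmulZl).
move: a; apply: (drinfeld_double_ext (l1 b c) (l2 b c)) => g x.
have l3 (u y : D) : linear (fun a : D => dmul u (dmul a y)).
  by move=> ? ? ?; rewrite !(dmulDl, dmulZl, dmulDr, dmulZr).
have l4 (u y : D) : linear (fun a : D => dmul (dmul u a) y).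
  by move=> ? ? ?; rewrite !(dmulDl, dmulZl, dmulDr, dmulZr).
move: b; apply: (drinfeld_double_ext (l3 _ c) (l4 _ c)) => h y.
have l5 (u v : D) : linear (fun a : D => dmul u (dmul v a)).
  by move=> ? ? ?; rewrite !(dmulDr, dmulZr).
have l6 (u v : D) : linear (fun a : D => dmul (dmul u v) a).
  by move=> ? ? ?; rewrite !(dmulDr, dmulZr).
move: c; apply: (drinfeld_double_ext (l5 _ _) (l6 _ _)) => l z.
rewrite !dmul_bowtie dmulZl dmulZr !dmul_bowtie !scalerA mulgA.
rewrite -!natrM !mulnb andbC; congr ((nat_of_bool _)%:R *: _).
case: (g =P (x * h * x^-1)%g) => //= ->; rewrite invMg !mulgA.
by rewrite (inj_eq (mulIg _)) -!mulgA (inj_eq (mulgI _)).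
Qed.

Lemma dmul1l : left_id dunit dmul.
Proof.
have l1 : linear (fun a : D => dmul dunit a).
  by move=> ? ? ?; rewrite dmulDr dmulZr.
have l2 : linear (fun a : D => a) by [].
apply: (drinfeld_double_ext l1 l2) => g x.
rewrite /dunit dmul_suml (bigD1 g) //= dmul_bowtie invg1 !mul1g mulg1.
rewrite eqxx scale1r big1 ?addr0 // => h /negPf hg.
by rewrite dmul_bowtie !mul1g invg1 mulg1 hg scale0r.
Qed.

Lemma dmul1r : right_id dunit dmul.
Proof.
have l1 : linear (fun a : D => dmul a dunit).
  by move=> ? ? ?; rewrite dmulDl dmulZl.
have l2 : linear (fun a : D => a) by [].
apply: (drinfeld_double_ext l1 l2) => g x.
rewrite /dunit dmul_sumr (bigD1 (g ^ x)%g) //= dmul_bowtie mulg1.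
rewrite conjgE !mulgA mulgV mul1g mulgK eqxx scale1r big1 ?addr0 // => h.
rewrite dmul_bowtie; case: (g =P _) => [-> /eqP[]|_ _]; last by rewrite scale0r.
by rewrite !mulgA mulVg mul1g mulgKV.
Qed.

Lemma dunit_neq0 : dunit != 0.
Proof.
apply/eqP => /ffunP /(_ (1, 1)%g) /eqP.
rewrite sum_ffunE (bigD1 1%g) //= big1 => [|h /negPf h1]; rewrite !ffunE.
  by rewrite eqxx addr0 oner_eq0.
by rewrite xpair_eqE [1%g == h]eq_sym h1.
Qed.

HB.instance Definition _ := GRing.Zmodule_isNzRing.Build D
  dmulA dmul1l dmul1r dmulDl dmulDr dunit_neq0.

Lemma dscaleAl (c : k) (a b : D) : c *: (a * b) = (c *: a) * b.
Proof. by rewrite -[RHS]/(dmul _ b) dmulZl. Qed.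
HB.instance Definition _ := GRing.Lmodule_isLalgebra.Build k D dscaleAl.

Lemma dscaleAr (c : k) (a b : D) : c *: (a * b) = a * (c *: b).
Proof. by rewrite -[RHS]/(dmul a _) dmulZr. Qed.
HB.instance Definition _ := GRing.Lalgebra_isAlgebra.Build k D dscaleAr.
HB.instance Definition _ := Algebra_isFalgebra.Build k D.

Definition dcomul : D -> tensor D D :=
  dlin (fun g x => \sum_h tens (bowtie h x) (bowtie (h^-1 * g)%g x)).
Definition dcounit : D -> k^o := dlin (fun g _ => (g == 1%g)%:R : k^o).
Definition dantipode : D -> D :=
  dlin (fun g x => bowtie (x^-1 * g^-1 * x)%g x^-1%g).
HB.instance Definition _ := GRing.Linear.on dcomul.
HB.instance Definition _ := GRing.Linear.on dcounit.
HB.instance Definition _ := GRing.Linear.on dantipode.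

Lemma bowtieM g z h y : bowtie g z * bowtie h y =
  (g == (z * h * z^-1)%g)%:R *: bowtie g (z * y)%g.
Proof. exact: dmul_bowtie. Qed.

Lemma drinfeld_double1E : 1 = \sum_g bowtie g 1%g.
Proof. by []. Qed.

Lemma dcomul_bowtie g x :
  dcomul (bowtie g x) = \sum_h tens (bowtie h x) (bowtie (h^-1 * g)%g x).
Proof. exact: dlin_bowtie. Qed.

Lemma dcounit_bowtie g x : dcounit (bowtie g x) = (g == 1%g)%:R.
Proof. exact: dlin_bowtie. Qed.

Lemma dantipode_bowtie g x :
  dantipode (bowtie g x) = bowtie (x^-1 * g^-1 * x)%g x^-1%g.
Proof. exact: dlin_bowtie. Qed.

Lemma tlift_dcomul (W : vectType k) (f : D -> D -> W) g x :
  (forall b, linear (fun a : D => f a b)) ->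
  (forall a, linear (fun b : D => f a b)) ->
  tlift f (dcomul (bowtie g x)) =
    \sum_h f (bowtie h x) (bowtie (h^-1 * g)%g x).
Proof.
move=> fl fr; rewrite dcomul_bowtie linear_sum.
by apply: eq_bigr => h _; apply: tlift_tens.
Qed.

Lemma dcomulA (a : D) :
  tlift (fun b c => tlift (fun d e => tens (tens b d) e) (dcomul c)) (dcomul a)
    = tlift (fun b c => tens (dcomul b) c) (dcomul a).
Proof.
have tl (U V : vectType k) := @tens_linearl k U V.
have tr (U V : vectType k) := @tens_linearr k U V.
have l1 (b : D) :
    linear (fun c : D => tlift (fun d e => tens (tens b d) e) (dcomul c)).
  by move=> ? ? ?; rewrite !linearP.
have l2 (c : D) :
    linear (fun b : D => tlift (fun d e => tens (tens b d) e) (dcomul c)).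
  by apply: tlift_linearl => d e ? ? ?; rewrite tl tl.
have l3 (c : D) : linear (fun b : D => tens (dcomul b) c).
  by move=> ? ? ?; rewrite linearP tl.
move: a; apply: drinfeld_double_ext => [? ? ?|? ? ?|g x]; rewrite ?linearP //.
rewrite (tlift_dcomul g x l2 l1) (tlift_dcomul g x l3 (fun b => @tr _ _ _)).
have -> : \sum_h tlift (fun d e => tens (tens (bowtie h x) d) e)
                    (dcomul (bowtie (h^-1 * g)%g x)) =
    \sum_h \sum_l tens (tens (bowtie h x) (bowtie l x))
                       (bowtie (l^-1 * (h^-1 * g))%g x).
  apply: eq_bigr => h _; apply: tlift_dcomul => [e ? ? ?|d ? ? ?].
    by rewrite tr tl.
  by rewrite tr.
have -> : \sum_h tens (dcomul (bowtie h x)) (bowtie (h^-1 * g)%g x) =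
    \sum_h \sum_l tens (tens (bowtie l x) (bowtie (l^-1 * h)%g x))
                       (bowtie (h^-1 * g)%g x).
  by apply: eq_bigr => h _; rewrite dcomul_bowtie tens_suml.
rewrite [RHS]exchange_big; apply: eq_bigr => h _ /=.
rewrite [RHS](reindex_inj (mulgI h)); apply: eq_bigr => l _ /=.
by rewrite mulKg invMg mulgA.
Qed.

Lemma dcounitl (a : D) : tlift (fun b c => (dcounit b : k) *: c) (dcomul a) = a.
Proof.
move: a; apply: drinfeld_double_ext => [? ? ?|//|g x].
  by rewrite !linearP.
rewrite tlift_dcomul => [|b ? ? ?|b ? ? ?].
- rewrite (bigD1 1%g) //= dcounit_bowtie eqxx scale1r invg1 mul1g.
  rewrite big1 ?addr0 // => h /negPf h1.
  by rewrite dcounit_bowtie h1 scale0r.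
- by rewrite linearP scalerDl scalerA.
- by rewrite linearP.
Qed.

Lemma dcounitr (a : D) : tlift (fun b c => (dcounit c : k) *: b) (dcomul a) = a.
Proof.
move: a; apply: drinfeld_double_ext => [? ? ?|//|g x].
  by rewrite !linearP.
rewrite tlift_dcomul => [|b ? ? ?|b ? ? ?].
- rewrite (bigD1 g) //= dcounit_bowtie mulVg eqxx scale1r.
  rewrite big1 ?addr0 // => h /negPf hg.
  by rewrite dcounit_bowtie -eq_mulVg1 hg scale0r.
- by rewrite linearP.
- by rewrite linearP scalerDl scalerA.
Qed.

Lemma dcomul1 : dcomul 1 = tens (1 : D) (1 : D).
Proof.
rewrite drinfeld_double1E linear_sum tens_suml /=.
under eq_bigr => g _ do rewrite dcomul_bowtie.
rewrite exchange_big /=; apply: eq_bigr => h _.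
rewrite tens_sumr (reindex_inj (mulgI h)) /=.
by apply: eq_bigr => g _; rewrite mulKg.
Qed.

Lemma dcomulM (a b : D) :
  dcomul (a * b) = tlift (fun c d => tlift (fun e f => tens (c * e) (d * f))
                                           (dcomul b)) (dcomul a).
Proof.
have tl (U V : vectType k) := @tens_linearl k U V.
have tr (U V : vectType k) := @tens_linearr k U V.
have l1 t (d : D) :
    linear (fun c : D => tlift (fun e f => tens (c * e) (d * f)) t).
  by apply: tlift_linearl => e f ? ? ?; rewrite mulrDl -scalerAl tl.
have l2 t (c : D) :
    linear (fun d : D => tlift (fun e f => tens (c * e) (d * f)) t).
  by apply: tlift_linearl => e f ? ? ?; rewrite mulrDl -scalerAl tr.
move: a; apply: drinfeld_double_ext => [? ? ?|? ? ?|g x].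
- by rewrite mulrDl -scalerAl !linearP.
- by rewrite !linearP.
move: b; apply: drinfeld_double_ext => [? ? ?|? ? ?|h y].
- by rewrite mulrDr -scalerAr !linearP.
- rewrite -tlift_linearP linearP; apply: eq_tlift => c d.
  by rewrite linearP.
rewrite bowtieM linearZ /= dcomul_bowtie tlift_dcomul //.
rewrite scaler_sumr; apply: eq_bigr => u _.
rewrite tlift_dcomul => [|d e ? ?|d e ? ?]; first last.
- by rewrite mulrDr -scalerAr tr.
- by rewrite mulrDr -scalerAr tl.
rewrite (bigD1 (u ^ x)%g) //= !bowtieM.
rewrite [X in _ + X]big1 ?addr0 => [|l /eqP neq_l]; last first.
  rewrite !bowtieM; case: (u =P _) => [def_u|_]; last first.
    by rewrite scale0r; apply: tens0l.
  by case: neq_l; rewrite def_u conjgE !mulgA mulVg mul1g mulgKV.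
rewrite conjgE !mulgA mulgV mul1g mulgK eqxx scale1r tensZr.
congr (_%:R *: _); congr nat_of_bool.
rewrite !invMg invgK !mulgA mulgV mul1g -[in RHS](inj_eq (mulgI u)) !mulgA.
by rewrite mulgV !mul1g.
Qed.

Lemma dcounit1 : dcounit 1 = 1.
Proof.
rewrite drinfeld_double1E linear_sum (bigD1 1%g) //= dcounit_bowtie eqxx.
by rewrite big1 ?addr0 // => g /negPf g1; rewrite dcounit_bowtie g1.
Qed.

Lemma dcounitM (a b : D) : dcounit (a * b) = dcounit a * dcounit b.
Proof.
move: a; apply: drinfeld_double_ext => [? ? ?|? ? ?|g x].
- by rewrite mulrDl -scalerAl linearP.
- by rewrite linearP /= mulrDl -scalerAl.
move: b; apply: drinfeld_double_ext => [? ? ?|? ? ?|h y].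
- by rewrite mulrDr -scalerAr linearP.
- by rewrite linearP /= mulrDr -scalerAr.
rewrite bowtieM linearZ /= !dcounit_bowtie -[_ *: _]/(_ * _) -!natrM !mulnb.
congr (_%:R); congr nat_of_bool.
case: (g =P 1%g) => [->|_]; last by rewrite andbF.
by rewrite andbT /= eq_sym -eq_mulgV1 -[X in _ == X]mulg1 (inj_eq (mulgI x)).
Qed.

Lemma dantipodel (a : D) :
  tlift (fun b c => dantipode b * c) (dcomul a) = (dcounit a : k)%:A.
Proof.
move: a; apply: drinfeld_double_ext => [? ? ?|? ? ?|g x].
- by rewrite !linearP.
- by rewrite linearP scalerDl scalerA.
rewrite tlift_dcomul => [|d e ? ?|d e ? ?]; first last.
- by rewrite mulrDr -scalerAr.
- by rewrite linearP mulrDl -scalerAl.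
rewrite dcounit_bowtie drinfeld_double1E scaler_sumr.
rewrite [RHS](reindex_inj (inj_comp (conjg_inj x) invg_inj)) /=.
apply: eq_bigr => h _; rewrite dantipode_bowtie bowtieM mulVg conjgE !mulgA.
congr (_%:R *: _); congr nat_of_bool.
rewrite invgK (inj_eq (mulIg _)) -[X in X == _]mulg1.
by rewrite (inj_eq (mulgI _)) eq_sym.
Qed.

Lemma dantipoder (a : D) :
  tlift (fun b c => b * dantipode c) (dcomul a) = (dcounit a : k)%:A.
Proof.
move: a; apply: drinfeld_double_ext => [? ? ?|? ? ?|g x].
- by rewrite !linearP.
- by rewrite linearP scalerDl scalerA.
rewrite tlift_dcomul => [|d e ? ?|d e ? ?]; first last.
- by rewrite linearP mulrDr -scalerAr.
- by rewrite mulrDl -scalerAl.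
rewrite dcounit_bowtie drinfeld_double1E scaler_sumr.
apply: eq_bigr => h _; rewrite dantipode_bowtie bowtieM mulgV.
congr (_%:R *: _); congr nat_of_bool.
rewrite invMg invgK !mulgA mulgV mul1g mulgK.
by rewrite -[X in X == _]mul1g (inj_eq (mulIg h)) eq_sym eq_invg1.
Qed.

HB.instance Definition _ := Falgebra_isHopf.Build k D
  dcomulA dcounitl dcounitr dcomul1 dcomulM dcounit1 dcounitM
  dantipodel dantipoder.

Definition drinfeld_integral : D :=
  #|gT|%:R^-1 *: \sum_x bowtie 1%g x.

Lemma drinfeld_integralP :
  #|gT|%:R != 0 :> k -> normalized_integral drinfeld_integral.
Proof.
move=> n0; split=> [a|]; last first.
  rewrite linearZ linear_sum /=.
  under eq_bigr => x _ do rewrite [counit _]dcounit_bowtie eqxx.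
  by rewrite sumr_const -[LHS]/(_ * _) mulVf.
split; move: a; apply: drinfeld_double_ext => [? ? ?|? ? ?|g z].
- by rewrite mulrDl -scalerAl.
- by rewrite linearP scalerDl; congr (_ + _); rewrite [RHS]scalerA.
- rewrite -scalerAr [RHS]scalerA mulrC -scalerA; congr (_ *: _).
  rewrite [counit _]dcounit_bowtie mulr_sumr scaler_sumr.
  rewrite [RHS](reindex_inj (mulgI z)); apply: eq_bigr => x _ /=.
  rewrite bowtieM mulg1 mulgV; case: eqP => [->//|_].
  by rewrite !scale0r.
- by rewrite mulrDr -scalerAr.
- by rewrite linearP scalerDl; congr (_ + _); rewrite [RHS]scalerA.
rewrite -scalerAl [RHS]scalerA mulrC -scalerA; congr (_ *: _).
rewrite [counit _]dcounit_bowtie mulr_suml scaler_sumr.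
rewrite [RHS](reindex_inj (mulIg z)); apply: eq_bigr => x _ /=.
rewrite bowtieM; congr (_%:R *: _); congr nat_of_bool.
by rewrite eq_sym -eq_mulgV1 -[X in _ == X]mulg1 (inj_eq (mulgI x)).
Qed.

End DrinfeldDouble.

(* Main.v *)
(* A simple D(G)-module V is a G-representation graded by G; a nonzero graded
   piece V_g is a simple module for C = 'C[g], and the indicator of V is the
   twisted indicator 1/|C| sum tr(x ^ 2 | V_g) over the x with g ^ x = g^-1.
   For G symmetric, let X contain one point of each cycle of g, and let t be
   the involution fixing X and inverting g; then twist c = (c^-1) ^ t is an
   anti-automorphism of C.  Let C_B be the subgroup of C fixing B, where B is a
   subset of X.  For c in C_B and s in X - B, the group <g, c> is abelian and
   B + s meets each of its orbits at most once, so some permutation fixing B + s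
   inverts both g and c: thus twist c is conjugate to c under C_(B + s).  As in
   the Gelfand-pair argument for multiplicity-free restriction, twist then acts
   trivially on the commutant of C_(B + s) in the algebra of C_B.  Following a
   chain of such subgroups down to the trivial group singles out, in every
   irreducible representation of C, a twist-invariant projection of rank 1,
   which forces the twisted indicator to be 1 by Schur orthogonality. *)

From HB Require Import structures.
Require Import Defs.
From mathcomp Require Import all_boot all_order all_algebra all_fingroup.
From mathcomp Require Import all_field all_character.
Import GRing.Theory VectorInternalTheory passmx.
Local Open Scope ring_scope.

Set Implicit Arguments.
Unset Strict Implicit.
Unset Printing Implicit Defensive.

(** * Schur orthogonality *)

Lemma mxtrace_delta (R : pzSemiRingType) n (i j : 'I_n) :
  \tr (delta_mx i j : 'M[R]_n) = (i == j)%:R.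
Proof.
rewrite /mxtrace (bigD1 i) //= big1 ?addr0 => [|l /negPf il].
  by rewrite mxE eqxx.
by rewrite mxE il.
Qed.

Section Schur.
Variables (F : closedFieldType) (gT : finGroupType) (G : {group gT}).
Hypothesis nzG : #|G|%:R != 0 :> F.

(** The sum commutes with [G], hence is a scalar; traces determine it through [a * n%:R], as [n%:R]
    is shown to be invertible only afterwards. *)
Lemma schur_average n (rG : mx_representation F G n) (X : 'M_n) :
  mx_irreducible rG ->
  exists2 a : F, \sum_(x in G) rG x^-1%g *m X *m rG x = a%:M
    & a * n%:R = #|G|%:R * \tr X.
Proof.
move=> irrG; set Y := \sum_(x in G) _.
have cY : centgmx rG Y.
  apply/centgmxP => y Gy; rewrite mulmx_suml mulmx_sumr.
  rewrite [RHS](reindex_inj (mulIg y)) /=.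
  apply: eq_big => [x|x Gx]; first by rewrite groupMr.
  rewrite [rG (x * y)%g]repr_mxM // !mulmxA -repr_mxM ?groupV ?groupM //.
  by rewrite invMg mulKVg.
have /is_scalar_mxP[a Ya] :=
  mx_abs_irr_cent_scalar (group_closure_closed_field irrG) cY.
exists a => //; have /(congr1 mxtrace) := Ya.
rewrite mxtrace_scalar raddf_sum /= mulr_natr => <-.
rewrite (eq_bigr (fun=> \tr X)) ?sumr_const ?mulr_natl // => x Gx.
by rewrite mxtrace_mulC mulmxA -repr_mxM ?groupV // mulgV repr_mx1 mul1mx.
Qed.

(** For a matrix unit of trace 1, the average gives [a * n%:R = #|G|%:R], which is nonzero. *)
Lemma irr_degree_neq0 n (rG : mx_representation F G n) :
  mx_irreducible rG -> n%:R != 0 :> F.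
Proof.
move=> irrG; have [_ nz1 _] := irrG; case: n => [|n] in rG irrG nz1 *.
  by rewrite (flatmx0 1%:M) eqxx in nz1.
have [a _] := schur_average (delta_mx 0 0) irrG.
rewrite mxtrace_delta; apply: contra_eqN => /eqP->.
by rewrite mulr0 mulr1 eq_sym.
Qed.

(** Fourier inversion: each entry of the sum comes from averages of matrix units, and only the unit
    of nonzero trace contributes. *)
Lemma schur_coefficients n (rG : mx_representation F G n) (X : 'M_n) :
  mx_irreducible rG ->
  \sum_(x in G) \tr (X *m rG x^-1%g) *: rG x = (#|G|%:R / n%:R) *: X.
Proof.
move=> irrG; have nzn := irr_degree_neq0 irrG.
apply/matrixP => i j; rewrite summxE mxE.
transitivity (\sum_a (X *m \sum_(x in G)
   rG x^-1%g *m (delta_mx a i : 'M_n) *m rG x) a j).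
  under [RHS]eq_bigr => a _ do rewrite mulmx_sumr summxE.
  rewrite exchange_big; apply: eq_bigr => x Gx /=.
  rewrite mxE /mxtrace mulr_suml; apply: eq_bigr => a _.
  rewrite -(mul_delta_mx (0 : 'I_1)) !mulmxA -colE -mulmxA -rowE.
  by rewrite !mxE big_ord1 !mxE.
rewrite (bigD1 i) //= [X in _ + X]big1 ?addr0 => [|a /negPf ai]; last first.
  have [c -> /eqP] := schur_average (delta_mx a i) irrG.
  rewrite mxtrace_delta ai mulr0 mulf_eq0 (negPf nzn) orbF => /eqP ->.
  by rewrite mul_mx_scalar scale0r mxE.
have [c -> Ec] := schur_average (delta_mx i i) irrG.
rewrite mul_mx_scalar mxE; congr (_ * _); apply: (mulIf nzn).
by rewrite Ec mxtrace_delta eqxx mulr1 mulfVK.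
Qed.

Lemma schur_orthogonality n (rG : mx_representation F G n) (A B : 'M_n) :
  mx_irreducible rG ->
  \sum_(x in G) \tr (A *m rG x^-1%g) * \tr (B *m rG x) =
    #|G|%:R / n%:R * \tr (A *m B).
Proof.
move=> irrG; rewrite [in RHS]mxtrace_mulC -mxtraceZ scalemxAr.
rewrite -(schur_coefficients _ irrG).
rewrite mulmx_sumr raddf_sum; apply: eq_bigr => x _ /=.
by rewrite -scalemxAr mxtraceZ.
Qed.

End Schur.

(** * Spherical projections and twisted indicators *)

(** [X = 1%:M] gives [E *m E = E], and the second clause makes the corner algebra of [E] a line.
    This form of rank 1 is the one that splits traces of products. *)
Definition rank1_projection (F : fieldType) n (E : 'M[F]_n) :=
  \tr E = 1 /\ forall X : 'M_n, E *m X *m E = \tr (E *m X) *: E.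

(** [b] is the inclusion of a simple submodule, acting on row vectors; [a] is a retraction made
    equivariant by averaging, as in Maschke's theorem. *)
Lemma irreducible_constituent (F : closedFieldType) (gT : finGroupType)
    (G : {group gT}) n (rG : mx_representation F G n) :
  #|G|%:R != 0 :> F -> (n > 0)%N ->
  exists m (r : mx_representation F G m) (b : 'M_(m, n)) (a : 'M_(n, m)),
  [/\ mx_irreducible r, b *m a = 1%:M,
      {in G, forall x, b *m rG x = r x *m b}
    & {in G, forall x, rG x *m a = a *m r x}].
Proof.
move=> nzG n_gt0; have nz1 : 1%:M != 0 :> 'M[F]_n.
  by rewrite -mxrank_eq0 mxrank1 -lt0n.
have [U simU _] := dec_mxsimple_exists (mxmodule1 rG) nz1.
have [modU _ _] := simU; exists (\rank U), (submod_repr modU).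
have : mx_irreducible (submod_repr modU) by apply/submod_mx_irr.
have : {in G, forall x, val_submod (U := U) 1%:M *m rG x =
                        submod_repr modU x *m val_submod (U := U) 1%:M}.
  by move=> x Gx; rewrite -(val_submodJ modU _ Gx) mul1mx -val_submodE.
have : val_submod (U := U) 1%:M *m in_submod U 1%:M = 1%:M.
  by rewrite -in_submodE val_submodK.
move: (submod_repr modU) (val_submod _) (in_submod _ _) => r b a0 ba0 bE irr.
exists b, (#|G|%:R^-1 *: \sum_(x in G) rG x^-1%g *m a0 *m r x); split=> //.
  rewrite -scalemxAr mulmx_sumr (eq_bigr (fun=> 1%:M)) => [|x Gx].
    by rewrite sumr_const -scaler_nat scalerA mulVf ?scale1r.
  rewrite !mulmxA bE ?groupV // -(mulmxA _ b) ba0 mulmx1.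
  by rewrite -repr_mxM ?groupV // mulVg repr_mx1.
move=> x Gx; rewrite -scalemxAr -scalemxAl; congr (_ *: _).
rewrite mulmx_suml mulmx_sumr [LHS](reindex_inj (mulIg x)) /=.
apply: eq_big => [y|y]; rewrite groupMr // => Gy.
have Gyx : (y * x)%g \in G by rewrite groupM.
rewrite [r (y * x)%g]repr_mxM // !mulmxA -repr_mxM ?groupV //.
by rewrite invMg mulKVg.
Qed.

Section Twisted.
Variables (F : closedFieldType) (gT : finGroupType) (twist : gT -> gT).
Hypothesis twistK : involutive twist.
Hypothesis twistM : {morph twist : x y / (x * y)%g >-> (y * x)%g}.

Lemma twist1 : twist 1%g = 1%g.
Proof. by apply: (mulgI (twist 1%g)); rewrite -twistM !mulg1. Qed.

Lemma twistV : {morph twist : x / x^-1%g >-> x^-1%g}.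
Proof.
by move=> x; apply: (mulgI (twist x)); rewrite -twistM mulVg mulgV twist1.
Qed.

Definition spherical (G : {group gT}) :=
  forall n (rG : mx_representation F G n), mx_irreducible rG ->
  exists2 E : 'M_n, rank1_projection E &
    {in G, forall x, \tr (E *m rG (twist x)) = \tr (E *m rG x)}.

(** The sum [N] of the matrices is equivariant, hence a scalar [a], and its trace is [a * n%:R].
    With [f] the coefficient of [E], [a] is the sum of the [f (twist x^-1 * x)], which is evaluated
    by repeated Schur orthogonality. *)
Lemma spherical_indicator (G : {group gT}) n (rG : mx_representation F G n) :
  #|G|%:R != 0 :> F -> {in G, forall x, twist x \in G} -> spherical G ->
  mx_irreducible rG ->
  \sum_(x in G) \tr (rG (twist x^-1 * x)%g) = #|G|%:R.
Proof.
move=> nzG tG sphG irrG; have [E [trE EXE] fE] := sphG n rG irrG.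
have nzn := irr_degree_neq0 nzG irrG.
have EE : E *m E = E by have := EXE 1%:M; rewrite !mulmx1 trE scale1r.
pose f x := \tr (E *m rG x).
have fE' x : x \in G -> f (twist x) = f x by move=> Gx; apply: fE.
pose N := \sum_(x in G) rG (twist x^-1 * x)%g.
have cN : centgmx rG N.
  apply/centgmxP => y Gy; rewrite mulmx_suml mulmx_sumr.
  (* After these substitutions both sides are the sum of the [rG (twist x^-1 * twist y * x)]. *)
  rewrite [LHS](reindex_inj (mulIg y^-1%g)).
  rewrite [RHS](reindex_inj (mulgI (twist y))) /=.
  have Gty : twist y \in G by apply: tG.
  apply: eq_big => [x|x]; first by rewrite groupMr ?groupV // groupMl.
  rewrite groupMr ?groupV // => Gx.
  have Gxy : (x * y^-1)%g \in G by rewrite groupM ?groupV.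
  have Gyx : (twist y * x)%g \in G by rewrite groupM.
  have Gt z : z \in G -> (twist z^-1 * z)%g \in G.
    by move=> Gz; rewrite groupM ?tG ?groupV.
  rewrite -!repr_mxM ?Gt //.
  congr (rG _); rewrite [(x * _)^-1%g]invMg [(twist y * x)^-1%g]invMg invgK.
  rewrite !twistM (twistV (twist y)) twistK.
  by rewrite !mulgA mulgV mul1g mulgKV.
have /is_scalar_mxP[a Na] :=
  mx_abs_irr_cent_scalar (group_closure_closed_field irrG) cN.
have <- : \tr N = \sum_(x in G) \tr (rG (twist x^-1 * x)%g).
  by rewrite raddf_sum.
rewrite Na mxtrace_scalar -(mulr_natr a).
suff -> : a = #|G|%:R / n%:R by rewrite mulfVK.
have -> : a = \sum_(x in G) f (twist x^-1 * x)%g.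
  rewrite -[LHS]mulr1 -trE -mxtraceZ -mul_mx_scalar -Na mulmx_sumr.
  by rewrite raddf_sum.
have orth A B := schur_orthogonality nzG A B irrG.
(* Orthogonality in [d] splits the trace, and invariance of [f] moves the twist from [x] to [d]; the
   sum over [x] is then again of orthogonality type. *)
have fM x : x \in G -> #|G|%:R / n%:R * f (twist x^-1 * x)%g =
    \sum_(d in G) f (twist d^-1 * x^-1)%g * f (d * x)%g.
  move=> Gx; rewrite /f repr_mxM ?tG ?groupV // -[in LHS]EE -mulmxA.
  rewrite mxtrace_mulC !mulmxA -[_ *m _ *m E]mulmxA -orth.
  apply: eq_bigr => d Gd; congr (_ * _); last first.
    by rewrite [in RHS]repr_mxM // mulmxA [RHS]mxtrace_mulC mulmxA.
  rewrite -mulmxA -repr_mxM ?tG ?groupV // -fE ?groupM ?tG ?groupV //.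
  by rewrite twistM twistK.
have cG0 : #|G|%:R / n%:R != 0 :> F by rewrite mulf_neq0 ?invr_eq0.
apply: (mulfI cG0); rewrite mulr_sumr (eq_bigr _ fM) exchange_big /=.
transitivity (\sum_(d in G) #|G|%:R / n%:R * (f d^-1%g * f d)).
  apply: eq_bigr => d Gd; rewrite -[in RHS]fE' ?groupV //.
  transitivity (\sum_(x in G) \tr (E *m rG (twist d^-1)%g *m rG x^-1%g) *
                              \tr (E *m rG d *m rG x)).
    apply: eq_bigr => x Gx.
    by rewrite -!mulmxA -!repr_mxM ?tG ?groupV.
  (* Rank 1 is used here: two copies of [E] in one trace split it into a product of values of
     [f]. *)
  rewrite orth; congr (_ * _); rewrite mulmxA EXE.
  by rewrite -scalemxAl mxtraceZ.
rewrite -mulr_sumr; congr (_ * _); rewrite /f orth EE trE mulr1 //.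
Qed.

(** The projection [E1] of a [K]-constituent is transported to [rG]. The coefficient of the
    resulting [E] is a convolution over [K] of that of [E1] with a [K]-class function, and both
    factors are invariant under [twist]. *)
Lemma spherical_step (G K : {group gT}) :
  K \subset G -> #|K|%:R != 0 :> F -> {in K, forall x, twist x \in K} ->
  {in G, forall x, exists2 v, v \in K & twist x = (x ^ v)%g} ->
  spherical K -> spherical G.
Proof.
move=> sKG nzK tK tG sphK n rG irrG.
have n_gt0 : (n > 0)%N.
  by case: irrG => _; rewrite -mxrank_eq0 mxrank1 lt0n.
have [m [r1 [b [r [irr1 br bE rE]]]]] :=
  irreducible_constituent (subg_repr rG sKG) nzK n_gt0.
rewrite /= in bE rE.
have [E1 [trE1 EXE1] fE1] := sphK _ r1 irr1.
pose E := r *m E1 *m b; exists E.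
  split=> [|X]; first by rewrite mxtrace_mulC mulmxA br mul1mx.
  have -> : E *m X *m E = r *m (E1 *m (b *m X *m r) *m E1) *m b.
    by rewrite /E !mulmxA.
  rewrite EXE1 -scalemxAr -scalemxAl; congr (_ *: _).
  by rewrite /E -!mulmxA [RHS]mxtrace_mulC !mulmxA.
(* [r *m b] projects onto a K-constituent and commutes with K, so that [th] is
   a K-class function, hence is invariant under [twist]. *)
pose th x := \tr (r *m b *m rG x).
have thJ v x : v \in K -> x \in G -> th (x ^ v)%g = th x.
  move=> Kv Gx; have Gv := subsetP sKG v Kv.
  have : rG v *m (r *m b) = r *m b *m rG v by rewrite mulmxA rE // -!mulmxA bE.
  rewrite /th; move: (r *m b) => p pv.
  rewrite conjgE !repr_mxM ?groupM ?groupV // !mulmxA mxtrace_mulC !mulmxA pv.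
  by rewrite -(mulmxA p) -repr_mxM ?groupV // mulgV repr_mx1 mulmx1.
have thT x : x \in G -> th (twist x) = th x.
  by move=> Gx; have [v Kv ->] := tG x Gx; rewrite thJ.
have c0 : #|K|%:R / m%:R != 0 :> F.
  by rewrite mulf_neq0 ?invr_eq0 ?(irr_degree_neq0 nzK irr1).
(* Schur orthogonality for [r1], applied to [E1] and the compression [b *m rG x *m r]. *)
have fE x : x \in G -> #|K|%:R / m%:R * \tr (E *m rG x) =
    \sum_(y in K) \tr (E1 *m r1 y^-1%g) * th (x * y)%g.
  move=> Gx; rewrite /E -!mulmxA mxtrace_mulC -[E1 *m _ *m _]mulmxA.
  rewrite -(schur_orthogonality nzK _ _ irr1); apply: eq_bigr => y Ky.
  have Gy := subsetP sKG y Ky.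
  congr (_ * _); rewrite -[_ *m r1 y]mulmxA -rE // /th.
  rewrite repr_mxM // [RHS]mxtrace_mulC -!mulmxA.
  by rewrite [LHS]mxtrace_mulC -!mulmxA.
move=> x Gx; apply: (mulfI c0).
have GtG z : z \in G -> twist z \in G.
  by move=> Gz; have [v Kv ->] := tG z Gz; rewrite groupJ // (subsetP sKG).
rewrite !fE ?GtG // [RHS](reindex_inj (inv_inj twistK)) /=.
have tKE y : (twist y \in K) = (y \in K).
  by apply/idP/idP => [/tK|/tK //]; rewrite twistK.
apply: eq_big => [y|y Ky]; first by rewrite tKE.
have [Gy Kty] := (subsetP sKG y Ky, tK y Ky).
rewrite -twistV fE1 ?groupV //; congr (_ * _).
(* [th (twist x * y) = th (twist y * x)] by invariance, and this is [th (x * twist y)] by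
   conjugation with [twist y]. *)
rewrite -thT ?groupM ?GtG // twistM twistK -(thJ _ _ Kty) ?groupM ?GtG //.
by rewrite conjgE mulgA mulKg.
Qed.

Lemma spherical_trivg (G : {group gT}) : G :=: 1%g -> spherical G.
Proof.
move=> G1 n rG irrG.
have n1 : n = 1%N.
  apply: (mx_irr_abelian_linear _ irrG); last by rewrite G1 abelian1.
  exact: group_closure_closed_field.
subst n; exists 1%:M; last first.
  move=> x Gx; have /set1gP -> : x \in (1%g : {set gT}) by rewrite -G1.
  by rewrite twist1.
split=> [|X]; first by rewrite mxtrace1.
by rewrite mulmx1 !mul1mx {1}[X]mx11_scalar scalemx1 trace_mx11.
Qed.

End Twisted.

(** * Inversions in symmetric groups *)

Section Perm.
Variable T : finType.
Implicit Types (H : {group {perm T}}) (B X : {set T}).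
Local Open Scope group_scope.

Definition separated H B :=
  [forall x in B, forall y in B, (y \in orbit 'P H x) ==> (x == y)].

Lemma separatedP H B :
  reflect {in B &, forall x y, y \in orbit 'P H x -> x = y} (separated H B).
Proof.
apply: (iffP forall_inP) => [sepB x y Bx By xy | sepB x Bx].
  by have /forall_inP/(_ y By)/implyP/(_ xy)/eqP := sepB x Bx.
by apply/forall_inP=> y By; apply/implyP => xy; apply/eqP; apply: sepB.
Qed.

(** A maximal separated set is a transversal: a point in an orbit not yet met could be adjoined. *)
Lemma separated_extend H B : separated H B ->
  exists X, [/\ B \subset X, separated H X
    & forall x, exists2 b, b \in X & x \in orbit 'P H b].
Proof.
move=> /maxset_exists[X /maxsetP[sepX maxX] sBX]; exists X; split=> // x.
have [[b Xb xb]|notx] :=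
  altP (@exists_inP _ (mem X) (fun b => x \in orbit 'P H b)).
  by exists b.
exists x; last exact: orbit_refl.
rewrite -(maxX (x |: X)) ?setU11 ?subsetUr //.
apply/separatedP => y z; rewrite !inE.
have {}notx b : b \in X -> x \notin orbit 'P H b.
  by move=> Xb; apply: contra notx => xb; apply/exists_inP; exists b.
case/predU1P => [->|Xy] /predU1P[->|Xz] //.
- by rewrite orbit_sym (negPf (notx _ _)).
- by rewrite (negPf (notx _ _)).
exact: (separatedP H X sepX).
Qed.

(** For a transversal [X] containing [B], [u] sends [h b] to [h^-1 b] for [h] in [H] and [b] in [X].
    This is well defined as [H] is abelian: applying [h^-1 * l^-1] to [h b = l b] gives
    [l^-1 b = h^-1 b]. *)
Lemma abelian_inversion H B : abelian H -> separated H B ->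
  exists u : {perm T}, [/\ u * u = 1, {in B, forall x, u x = x}
    & {in H, forall h, h ^ u = h^-1}].
Proof.
move=> /centsP abH /separated_extend[X [sBX /separatedP sepX covX]].
have /fin_all_exists[b /fin_all_exists[h hb]] x :
    exists b, exists h : {perm T}, [&& b \in X, h \in H & x == h b].
  have [b Xb /orbitP[h Hh <-]] := covX x.
  by exists b, h; rewrite Xb Hh /=.
pose u0 x := (h x)^-1 (b x).
(* The value of [u0] does not depend on the chosen [h x]. *)
have u0E k c : k \in H -> c \in X -> u0 (k c) = k^-1 c.
  move=> Hk Xc; have /and3P[Xb Hh /eqP e] := hb (k c).
  have bc : b (k c) = c.
    apply: sepX => //; apply/orbitP; exists (h (k c) * k^-1).
      by rewrite groupM ?groupV.
    by rewrite /= /aperm permM -e permK.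
  rewrite /u0 bc in e *; set l := h _ in e Hh *.
  apply: (@perm_inj _ (k * l)); rewrite -!permM.
  rewrite (abH k Hk l Hh) mulKg -(abH k Hk l Hh) mulKg.
  by [].
have uK : involutive u0.
  move=> x; have /and3P[Xb Hh /eqP e] := hb x.
  by rewrite {1}e u0E // u0E ?groupV // invgK -e.
exists (perm (inv_inj uK)); split=> [|x Bx|k Hk].
- by apply/permP => x; rewrite permM !permE uK.
- rewrite permE -{1}[x](perm1 x) u0E ?(subsetP sBX) //.
  by rewrite invg1 perm1.
apply/permP => x; have /and3P[Xb Hh /eqP e] := hb x.
have uV : (perm (inv_inj uK))^-1 = perm (inv_inj uK).
  apply/eqP; rewrite eq_invg_mul; apply/eqP/permP => y.
  by rewrite permM !permE uK.
have pE := @permE _ u0 (inv_inj uK).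
rewrite conjgE uV !permM !pE {1}e (u0E (h x)) //.
rewrite -(permM (h x)^-1 k) u0E ?groupM ?groupV // [in RHS]e.
rewrite -(permM (h x) k^-1); congr (fun_of_perm _ _).
by rewrite invMg invgK abH // groupV.
Qed.

End Perm.

(** * Twist-invariant projections for centralizers in symmetric groups *)

Section Centralizer.
Variables (F : closedFieldType) (T : finType).
Hypothesis nzF : forall K : {group {perm T}}, #|K|%:R != 0 :> F.
Local Open Scope group_scope.

Lemma spherical_centralizer (g : {perm T}) :
  exists t : {perm T}, [/\ t * t = 1, g ^ t = g^-1
    & spherical F (fun x => (x^-1) ^ t) [group of 'C[g]]].
Proof.
have sep0 : separated <[g]> set0 by apply/separatedP => x; rewrite inE.
have [X [_ sepX covX]] := separated_extend sep0.
have [t [tt tX tg]] := abelian_inversion (cycle_abelian g) sepX.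
have gt : g ^ t = g^-1 by apply: tg; apply: cycle_id.
have tV : t^-1 = t by apply/eqP; rewrite eq_invg_mul; apply/eqP.
exists t; split=> //; set tw := fun _ => _.
have twK : involutive tw.
  by move=> x; rewrite /tw -conjVg invgK -conjgM tt conjg1.
have twM : {morph tw : x y / x * y >-> y * x}.
  by move=> x y; rewrite /tw invMg conjMg.
(* The induction below starts from [G_ X], which is trivial, and removes points from [B] until
   [G_ set0] is the whole centralizer. *)
pose G_ (B : {set T}) := ('C[g] :&: 'C(B | 'P))%G.
have GP (B : {set T}) c :
  reflect (commute g c /\ {in B, forall x, c x = x}) (c \in G_ B).
  rewrite inE; apply: (iffP andP) => [[/cent1P cg /astabP cB]|[cg cB]].
    by split=> // x /cB.
  by split; [apply/cent1P | apply/astabP => x /cB].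
have tw_G (B : {set T}) : B \subset X -> {in G_ B, forall c, tw c \in G_ B}.
  move=> sBX c /GP[cg cB]; apply/GP; split.
    have gE : g = g^-1 ^ t by rewrite conjVg gt invgK.
    by rewrite /commute {1 2}gE /tw -!conjMg -!invMg cg.
  move=> x Bx; rewrite /tw conjgE tV !permM (tX x) ?(subsetP sBX) //.
  have -> : c^-1 x = x by rewrite -{1}(cB x Bx) permK.
  by rewrite tX ?(subsetP sBX).
have sphG m (B : {set T}) :
  B \subset X -> #|X :\: B| = m -> spherical F tw (G_ B).
  elim: m B => [|m IH] B sBX cardB.
    (* Here [B = X]: a permutation that commutes with [g] and fixes a point of each cycle of [g] is
       trivial. *)
    apply: spherical_trivg => //.
    apply/trivgP/subsetP => c /GP[cg cB]; apply/set1gP/permP => x.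
    have [b Xb /orbitP[_ /cycleP[i ->] <-]] := covX x.
    rewrite /= /aperm -permM -(commuteX i (commute_sym cg)) permM cB ?perm1 //.
    by move/eqP: cardB; rewrite cards_eq0 setD_eq0 => /subsetP; apply.
  have [s] : exists s, s \in X :\: B by apply/card_gt0P; rewrite cardB.
  rewrite inE => /andP[sB sX].
  have sBX' : s |: B \subset X by rewrite subUset sub1set sX.
  have sGG : G_ (s |: B) \subset G_ B.
    apply/subsetP => c /GP[cg cB]; apply/GP; split=> // x Bx.
    by apply: cB; rewrite inE Bx orbT.
  apply: (spherical_step twK twM sGG (nzF _) (tw_G _ sBX')); last first.
    apply: IH => //; apply/eqP; rewrite -eqSS -cardB (cardsD1 s (X :\: B)).
    by rewrite !inE sB sX add1n setDDl setUC.
  move=> c /GP[cg cB].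
  pose H := (<[g]> <*> <[c]>)%G.
  have HE : H = <[g]> * <[c]> :> {set _}.
    rewrite /= cent_joinEr // cent_cycle cycle_subG; exact/cent1P.
  have abH : abelian H.
    rewrite /= abelianY !cycle_abelian /= cent_cycle cycle_subG; exact/cent1P.
  (* As [c] fixes [B] and commutes with [g], a point of [B] has the same orbit under [H] as under
     [<[g]>]. Two distinct points of [s |: B] include one of [B], so separation by [<[g]>]
     suffices. *)
  have sepH : separated H (s |: B).
    have Borb (x y : T) :
      x \in B -> y \in orbit 'P H x -> y \in orbit 'P <[g]> x.
      move=> Bx /orbitP[h]. rewrite HE => /mulsgP[a b ga /cycleP[i ->] ->] <-.
      apply/orbitP; exists a => //=; rewrite /aperm.
      have /cycleP[j ->] := ga.
      have cij : commute (g ^+ j) (c ^+ i).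
        by apply: commuteX; apply/commute_sym/commuteX/commute_sym.
      have cx : (c ^+ i) x = x by rewrite permX iter_fix ?cB.
      by rewrite cij permM cx.
    have BX (x : T) : x \in B -> x \in X by apply: subsetP.
    have sXP := separatedP _ _ sepX.
    apply/separatedP => x y; rewrite !inE.
    case/predU1P => [->|Bx] /predU1P[->|By] // xy.
    - symmetry; apply: (sXP _ _ (BX y By) sX).
      by apply: Borb => //; rewrite orbit_sym.
    - by apply: (sXP _ _ (BX x Bx) sX); apply: Borb.
    by apply: (sXP _ _ (BX x Bx) (BX y By)); apply: Borb.
  have [u [uu uB uH]] := abelian_inversion abH sepH.
  have ug : g ^ u = g^-1.
    by apply: uH; rewrite (subsetP (joing_subl _ _)) ?cycle_id.
  have uc : c ^ u = c^-1.
    by apply: uH; rewrite (subsetP (joing_subr _ _)) ?cycle_id.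
  (* [u] and [t] both invert [g], so [u * t] centralizes it, while [c ^ (u * t) = (c^-1) ^ t] is
     [tw c]. *)
  exists (u * t); last by rewrite conjgM uc.
  apply/GP; split; last first.
    by move=> x Bx; rewrite permM uB ?tX //; apply: (subsetP sBX').
  by apply/commgP/conjg_fixP; rewrite conjgM ug conjVg gt invgK.
have := sphG _ set0 (sub0set _) erefl.
suff -> : G_ set0 = [group of 'C[g]] by [].
apply/val_inj/setP => c /=; apply/GP/idP => [[? _]|/cent1P cg].
  exact/cent1P.
by split=> // x; rewrite inE.
Qed.
End Centralizer.

(** * Graded representations *)

Section Imprimitive.
Variables (F : fieldType) (gT : finGroupType) (n : nat).
Variables (R : mx_representation F [set: gT] n) (P : gT -> 'M[F]_n).
Hypothesis PP : forall g h, P g *m P h = (g == h)%:R *: P g.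
Hypothesis RP : forall x g, R x *m P g = P (g ^ x^-1)%g *m R x.
Hypothesis simpleRP : forall U : 'M_n,
  (forall x, (U *m R x <= U)%MS) -> (forall g, (U *m P g <= U)%MS) ->
  U != 0 -> row_full U.

Let RM x y : R (x * y)%g = R x *m R y.
Proof. by rewrite repr_mxM ?inE. Qed.

(** [W] lies in the component of [g], so [W *m R x] lies in that of [g ^ x]; the sum of the
    translates is therefore stable under the grading too. *)
Lemma full_of_orbit m (g : gT) (W : 'M_(m, n)) : W != 0 -> W *m P g = W ->
  row_full (\sum_x <<W *m R x>>)%MS.
Proof.
move=> nzW WP; set U := (\sum_x _)%MS.
have WU x : (W *m R x <= U)%MS.
  by rewrite (sumsmx_sup x) // genmxE.
have UP (A B : 'M_n) : (forall x, (W *m R x *m A <= B)%MS) -> (U *m A <= B)%MS.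
  move=> WAB; rewrite sumsmxMr; apply/sumsmx_subP => x _.
  by rewrite (eqmxMr _ (genmxE _)).
apply: simpleRP => [y|h|].
- by apply: UP => x; rewrite -mulmxA -RM.
- apply: UP => x; rewrite -WP -(mulmxA W) -[X in (X <= _)%MS]mulmxA.
  rewrite -(mulmxA (P g)) RP (mulmxA (P g)) PP.
  rewrite -scalemxAl -scalemxAr scalemx_sub //.
  by rewrite mulmxA WP.
apply: contraNneq nzW => U0; rewrite -submx0 -U0.
by rewrite -[W]mulmx1 -(repr_mx1 R).
Qed.

(** The centralizer acts on the image of [P g]. A nonzero submodule of it generates the whole space,
    and projecting its translates back to the component of [g] keeps only those by the centralizer,
    which already lie in it. *)
Lemma fiber_representation (g : gT) : P g != 0 ->
  exists m (r : mx_representation F [group of 'C[g]%g] m), mx_irreducible r /\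
    {in 'C[g]%g, forall c, \tr (r c) = \tr (P g *m R c)}.
Proof.
move=> nzP.
move: (mulmx_base (P g)) (row_base_free (P g)) (col_base_full (P g)).
move: (\rank (P g)) (row_base (P g)) (col_base (P g)) => m b a ab fb fa.
(* [P g = a *m b] is a rank factorization of an idempotent. *)
have ba : b *m a = 1%:M.
  have PPg : P g *m P g = P g by rewrite PP eqxx scale1r.
  apply: (row_free_inj fb); rewrite mul1mx; apply: (row_full_inj fa).
  by rewrite !mulmxA ab -mulmxA ab.
have nzb : b != 0.
  by apply: contraNneq nzP => b0; rewrite -ab b0 mulmx0.
have bP : b *m P g = b by rewrite -ab mulmxA ba mul1mx.
have Pa : P g *m a = a by rewrite -ab -mulmxA ba mulmx1.
have cP c : c \in 'C[g]%g -> R c *m P g = P g *m R c.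
  move=> /cent1P cg; rewrite RP; congr (P _ *m _).
  exact/conjg_fixP/commgP/commuteV/commute_sym.
pose r c := b *m R c *m a.
have rP : mx_repr 'C[g]%g r.
  split=> [|c d Cc Cd]; first by rewrite /r repr_mx1 mulmx1.
  rewrite /r RM !mulmxA -(mulmxA _ a b) ab -(mulmxA b _ (P g)) cP //.
  by rewrite mulmxA bP.
exists _, (MxRepresentation rP); split; last first.
  by move=> c Cc /=; rewrite /r mxtrace_mulC mulmxA ab.
split=> [||U modU _ nzU]; first exact: mxmodule1.
  by apply: contraNneq nzb => b0; rewrite -[b]mul1mx b0 mul0mx.
have UbP : U *m b *m P g = U *m b by rewrite -mulmxA bP.
have nzUb : U *m b != 0.
  apply: contraNneq nzU => Ub0; by rewrite -[U]mulmx1 -ba mulmxA Ub0 mul0mx.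
have full := full_of_orbit nzUb UbP.
have : (b *m a <= U)%MS; last by rewrite ba.
apply: submx_trans (submxMr a (submx_full b full)) _.
rewrite sumsmxMr_gen; apply/sumsmx_subP => x _.
rewrite genmxE (eqmxMr _ (genmxE _)).
rewrite -Pa mulmxA -(mulmxA _ (R x)) RP mulmxA -[U *m b]UbP.
rewrite -(mulmxA _ (P g)) PP.
case: eqP => [gx|_]; last by rewrite scale0r mulmx0 !mul0mx sub0mx.
rewrite scale1r UbP -!mulmxA (mulmxA b).
apply: (mxmoduleP modU); apply/cent1P/commute_sym/commgP/conjg_fixP.
by rewrite {1}gx conjgKV.
Qed.

(** The translates of the image of [P g] fill the space and lie in components indexed by conjugates
    of [g]. *)
Lemma support_class g h : P g != 0 -> P h != 0 -> h \in (g ^: [set: gT])%g.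
Proof.
move=> nzg nzh; apply: contraR nzh => ngh.
have full := full_of_orbit nzg (_ : P g *m P g = P g).
rewrite -[P h]mul1mx -submx0.
apply: submx_trans (submxMr _ (submx_full _ (full _))) _.
  by rewrite PP eqxx scale1r.
rewrite sumsmxMr; apply/sumsmx_subP => x _; rewrite (eqmxMr _ (genmxE _)).
rewrite -mulmxA RP mulmxA PP; case: eqP => [gh|_]; last first.
  by rewrite scale0r mul0mx.
by case/imsetP: ngh; exists x; rewrite ?inE // gh conjgKV.
Qed.

(** The inner sum is a class function of [h] that vanishes off the class of [g]. *)
Lemma indicator_fiber g : P g != 0 ->
  \sum_h \sum_(x | (h ^ x)%g == h^-1%g) \tr (P h *m R (x * x)%g) =
  #|(g ^: [set: gT])%g|%:R *
    \sum_(x | (g ^ x)%g == g^-1%g) \tr (P g *m R (x * x)%g).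
Proof.
move=> nzg; pose T h := \sum_(x | (h ^ x)%g == h^-1%g) \tr (P h *m R (x * x)%g).
have TJ y h : T (h ^ y)%g = T h.
  rewrite /T (reindex_inj (conjg_inj y)) /=; apply: eq_big => [x|x _].
    by rewrite -conjVg -conjJg (inj_eq (conjg_inj y)).
  rewrite -conjMg [((x * x) ^ y)%g]conjgE RM mulmxA -{1}[y]invgK -RP -mulmxA.
  rewrite mxtrace_mulC.
  by rewrite -!mulmxA -!RM -!mulgA mulgV mulg1.
rewrite -[RHS]/(_ * T g) mulr_natl -sumr_const.
rewrite [LHS](bigID (mem (g ^: [set: gT])%g)) /=.
rewrite -[X in _ = X]addr0; congr (_ + _).
  by apply: eq_bigr => _ /imsetP[y _ ->]; apply: TJ.
rewrite big1 // => h; apply: contraNeq => nzT; apply: support_class => //.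
apply: contraNneq nzT => h0; rewrite big1 // => x _.
by rewrite h0 mul0mx mxtrace0.
Qed.

End Imprimitive.

Lemma indicator_sum (F : closedFieldType) (T : finType) n
    (R : mx_representation F [set: {perm T}] n) (P : {perm T} -> 'M[F]_n) g0 :
  (forall K : {group {perm T}}, #|K|%:R != 0 :> F) ->
  (forall g h, P g *m P h = (g == h)%:R *: P g) ->
  (forall x g, R x *m P g = P (g ^ x^-1)%g *m R x) ->
  (forall U : 'M_n, (forall x, (U *m R x <= U)%MS) ->
     (forall g, (U *m P g <= U)%MS) -> U != 0 -> row_full U) ->
  P g0 != 0 ->
  \sum_h \sum_(x | (h ^ x)%g == h^-1%g) \tr (P h *m R (x * x)%g) =
    #|[set: {perm T}]|%:R.
Proof.
move=> nzF PP RP simpleRP nzP.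
rewrite (indicator_fiber PP RP simpleRP nzP).
have [m [r [irr_r trr]]] := fiber_representation PP RP simpleRP nzP.
have [t [tt gt sph]] := spherical_centralizer nzF g0.
have tV : t^-1%g = t by apply/eqP; rewrite eq_invg_mul; apply/eqP.
set tw := fun _ => _ in sph.
have twK : involutive tw.
  by move=> x; rewrite /tw -conjVg invgK -conjgM tt conjg1.
have twM : {morph tw : x y / (x * y)%g >-> (y * x)%g}.
  by move=> x y; rewrite /tw invMg conjMg.
have CP c : (c \in 'C[g0]%g) = (g0 ^ c == g0)%g.
  apply/cent1P/eqP => [/commute_sym /commgP/conjg_fixP //|cg].
  by apply/commute_sym/commgP/conjg_fixP.
have twC : {in [group of 'C[g0]%g], forall x, tw x \in [group of 'C[g0]%g]}.
  move=> c; rewrite /= !CP /tw => /eqP cg.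
  rewrite [((c^-1) ^ t)%g]conjgE tV !conjgM gt.
  have -> : (g0^-1 ^ c^-1)%g = g0^-1%g by rewrite -{1}cg conjVg conjgK.
  by rewrite conjVg gt invgK.
have := spherical_indicator twK twM (nzF _) twC sph irr_r.
set S1 := \sum_(x in _) _; set S2 := \sum_(x | _) _ => S1E.
have -> : S2 = S1.
  (* The [x] inverting [g0] form the coset of the [t * c] with [c] in the centralizer, and
     [(t * c) * (t * c) = tw c^-1 * c]. *)
  rewrite /S2 (reindex_inj (mulgI t)) /=; apply: eq_big => [c|c].
    by rewrite CP conjgM gt conjVg (inj_eq invg_inj).
  rewrite conjgM gt conjVg (inj_eq invg_inj) -CP => Cc.
  rewrite trr; last by rewrite groupM // twC ?groupV.
  by rewrite /tw invgK conjgE tV !mulgA.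
rewrite S1E -natrM -index_cent1 mulnC.
by rewrite setTI Lagrange ?subsetT.
Qed.

(** * Modules over the Drinfeld double *)

Section Double.
Variables (k : fieldType) (gT : finGroupType).
Notation D := (drinfeld_double k gT).

(** The image of [x] under the embedding of the group algebra in its double. *)
Definition grouplike (x : gT) : D := \sum_g bowtie k g x.

Lemma bowtie_grouplike g x y :
  bowtie k g x * grouplike y = bowtie k g (x * y)%g.
Proof.
rewrite mulr_sumr (bigD1 (g ^ x)%g) //= bowtieM big1 => [|h /eqP hg].
  by rewrite addr0 conjgE !mulgA mulgV mul1g mulgK eqxx scale1r.
rewrite bowtieM; case: eqP => [gh|_]; last by rewrite scale0r.
by case: hg; rewrite gh conjgE !mulgA mulVg mul1g mulgKV.
Qed.

Lemma grouplike_bowtie g x y :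
  grouplike x * bowtie k g y = bowtie k (g ^ x^-1)%g (x * y)%g.
Proof.
rewrite mulr_suml (bigD1 (g ^ x^-1)%g) //= bowtieM conjgE invgK.
rewrite mulgA eqxx scale1r big1 ?addr0 // => h /negPf hg.
by rewrite bowtieM hg scale0r.
Qed.

Lemma grouplikeM x y : grouplike x * grouplike y = grouplike (x * y)%g.
Proof.
by rewrite mulr_suml; apply: eq_bigr => g _; rewrite bowtie_grouplike.
Qed.


Lemma sum_bowtie1 : \sum_g bowtie k g 1%g = 1 :> D.
Proof. by rewrite drinfeld_double1E. Qed.

(** The coproduct of [bowtie 1 x] pairs [h] with [h^-1], and the product of such a pair survives
    exactly when [x] conjugates [h] to its inverse. *)
Lemma comul_integral_mul :
  tlift *%R (comul (drinfeld_integral k gT)) =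
    #|gT|%:R^-1 *: \sum_h \sum_(x | (h ^ x)%g == h^-1%g) bowtie k h (x * x)%g.
Proof.
rewrite /drinfeld_integral !linearZ /=; congr (_ *: _).
rewrite [dcomul _]linear_sum [LHS]linear_sum /=.
rewrite [RHS](exchange_big_dep xpredT) //=; apply: eq_bigr => x _.
rewrite [LHS]tlift_dcomul => [|b ? ? ?|b ? ? ?]; first last.
- by rewrite mulrDr -scalerAr.
- by rewrite mulrDl -scalerAl.
rewrite [RHS]big_mkcond; apply: eq_bigr => h _ /=; rewrite mulg1 bowtieM.
have -> : (h == x * h^-1 * x^-1)%g = (h ^ x == h^-1)%g.
  rewrite -(inj_eq (conjg_inj x)) -[(x * h^-1 * x^-1)%g]mulgA.
  by rewrite [RHS]eq_sym eq_sym /conjg !mulgA mulVg mul1g !mulgKV.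
by case: ifP; rewrite ?scale1r ?scale0r.
Qed.

Variables (V : vectType k) (M : lmodule D V).
Notation e := (vbasis (fullv : {vspace V})).
Let eB : basis_of fullv e := vbasisP _.

Definition module_mx (a : D) := mxof e e (M a).

Lemma module_mx_linear : linear module_mx.
Proof. by move=> c a b; rewrite /module_mx !linearP. Qed.
HB.instance Definition _ := GRing.isLinear.Build k D _ _ module_mx
  module_mx_linear.

Lemma module_mxM a b : module_mx (a * b) = module_mx b *m module_mx a.
Proof. by rewrite /module_mx module_actM (mxof_comp e e eB). Qed.

Lemma module_mx1 : module_mx 1 = 1%:M.
Proof. by rewrite /module_mx module_act1 mxof1 // (basis_free eB). Qed.

Lemma module_mx_simple (U : 'M_(\dim (fullv : {vspace V}))) :
  simple_module M -> (forall a, (U *m module_mx a <= U)%MS) -> U != 0 ->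
  row_full U.
Proof.
move=> [_ simM] stabU nzU; case: (simM (vsof e U)) => [a||full].
- apply/subvP => _ /memv_imgP[v + ->]; rewrite -!(rVof_sub eB) => vU.
  rewrite (rVof_app e eB).
  exact: submx_trans (submxMr _ vU) (stabU a).
- by move/eqP; rewrite (vsof_eq0 eB) (negPf nzU).
rewrite -sub1mx; apply/rV_subP => u _.
by rewrite -[u](vecofK eB) (rVof_sub eB) full memvf.
Qed.

(* [mxof] acts on row vectors, so [module_mx] reverses products; the inverse
   restores a homomorphism. *)
Definition translation_mx (x : gT) := module_mx (grouplike x^-1).

Lemma translation_mx_repr : mx_repr [set: gT] translation_mx.
Proof.
split=> [|x y _ _]; last first.
  by rewrite /translation_mx invMg -grouplikeM module_mxM.
by rewrite /translation_mx invg1 /grouplike sum_bowtie1 module_mx1.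
Qed.
Canonical translation_repr := MxRepresentation translation_mx_repr.

Definition fiber_mx (g : gT) := module_mx (bowtie k g 1).

Lemma module_mx_bowtie g x :
  module_mx (bowtie k g x) = translation_mx x^-1 *m fiber_mx g.
Proof.
by rewrite -module_mxM invgK bowtie_grouplike mul1g.
Qed.

Lemma fiber_mxM g h :
  fiber_mx g *m fiber_mx h = (g == h)%:R *: fiber_mx g.
Proof.
rewrite -module_mxM bowtieM mul1g invg1 !mulg1 linearZ /= eq_sym.
by case: eqP => [->|_]; rewrite ?scale0r.
Qed.

Lemma translation_component x g : translation_mx x *m fiber_mx g =
  fiber_mx (g ^ x^-1)%g *m translation_mx x.
Proof.
rewrite -!module_mxM bowtie_grouplike grouplike_bowtie mulg1 mul1g.
by rewrite invgK conjgKV.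
Qed.

(** The fiber projections sum to the identity of a nonzero space. *)
Lemma fiber_mx_neq0 : simple_module M -> exists g, fiber_mx g != 0.
Proof.
move=> [nzV _]; apply/existsP; apply: contraNT nzV.
rewrite negb_exists => /forallP allP0.
rewrite -dimv_eq0 -leqn0 -[\dim _](@mxrank1 k).
rewrite -module_mx1 -sum_bowtie1 linear_sum big1 ?mxrank0 // => g _.
by apply/eqP; have := allP0 g; rewrite negbK.
Qed.

Lemma stable_module_mx (U : 'M_(\dim (fullv : {vspace V}))) a :
  (forall x, (U *m translation_mx x <= U)%MS) ->
  (forall g, (U *m fiber_mx g <= U)%MS) -> (U *m module_mx a <= U)%MS.
Proof.
move=> UR UP; rewrite -(dlin_id a) /dlin linear_sum mulmx_sumr.
apply: summx_sub => g _; rewrite linear_sum mulmx_sumr.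
apply: summx_sub => x _; rewrite linearZ /= -scalemxAr scalemx_sub //.
rewrite module_mx_bowtie mulmxA; exact: submx_trans (submxMr _ (UR _)) (UP g).
Qed.

Lemma schur_indicatorE :
  schur_indicator (drinfeld_integral k gT) M = #|gT|%:R^-1 *
    \sum_h \sum_(x | (h ^ x)%g == h^-1%g)
      \tr (fiber_mx h *m translation_mx (x * x)%g).
Proof.
rewrite /schur_indicator comul_integral_mul -[LHS]/(\tr (module_mx _)).
rewrite linearZ /= mxtraceZ; congr (_ * _).
rewrite linear_sum raddf_sum; apply: eq_bigr => h _ /=.
(* This undoes the inverse in [translation_mx]; [x] and [x^-1] satisfy the condition [h ^ x = h^-1]
   together. *)
rewrite linear_sum raddf_sum (reindex_inj invg_inj) /=.
apply: eq_big => [x|x _].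
  rewrite -(inj_eq (conjg_inj x)) conjgKV -(inj_eq invg_inj) conjVg invgK.
  by rewrite eq_sym.
by rewrite module_mx_bowtie invMg invgK mxtrace_mulC.
Qed.

End Double.

Theorem theorem6p3 (k : closedFieldType) (n : nat)
  (char_not2 : 2%N \notin [pchar k])
  (char_ndvd : forall p : nat,
     p \in [pchar k] -> ~~ (p %| #|[set: 'S_n]|)%N)
  (n_ge1 : (1 <= n)%N)
  (L : drinfeld_double k 'S_n) (intL : normalized_integral L)
  (V : vectType k) (M : lmodule (drinfeld_double k 'S_n) V) :
  simple_module M -> schur_indicator L M = 1.
Proof.
move=> simM.
(* By Lagrange, the characteristic divides no subgroup order either. *)
have nzF (K : {group 'S_n}) : #|K|%:R != 0 :> k.
  apply/negP => K0; have [p chp] := natf0_pchar (cardG_gt0 K) K0.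
  have := char_ndvd p chp; rewrite (dvdn_trans _ (cardSg (subsetT K))) //.
  by rewrite (dvdn_pcharf chp).
have nzS : #|{: 'S_n}|%:R != 0 :> k.
  by rewrite -cardsT; apply: nzF [set: 'S_n]%G.
rewrite (normalized_integral_uniq intL (drinfeld_integralP nzS)).
have [g nzg] := fiber_mx_neq0 simM.
rewrite schur_indicatorE -cardsT.
have := @indicator_sum k _ _ (translation_repr M) (fiber_mx M) g nzF.
move=> -> //; first by rewrite mulVf // cardsT.
- exact: fiber_mxM.
- exact: translation_component.
move=> U UR UP; apply: module_mx_simple simM _ => a.
exact: stable_module_mx.
Qed.
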